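(* Let $\mathcal{M}_{\mathrm{syn}}$ be a randomized mechanism mapping a private database $D$ to a synthetic database $\widetilde D=\mathcal{M}_{\mathrm{syn}}(D)$, let $f$ be a (possibly randomized) query-selection procedure that takes as input only $\widetilde D$ and public inputs (the natural-language question and the schema) and outputs a query $q^\star=f(\widetilde D)$ in a class $\mathcal Q$ of queries, and for each $q\in\mathcal Q$ let $\mathcal{M}_{\mathrm{rel}}(\cdot\,;q)$ be a randomized release mechanism. Let $\mathcal M$ be the end-to-end mechanism $$\mathcal M(D)=\bigl(\widetilde D,\ \mathcal{M}_{\mathrm{rel}}(D;q^\star)\bigr),\qquad \widetilde D=\mathcal{M}_{\mathrm{syn}}(D),\quad q^\star=f(\widetilde D).$$ If $\mathcal{M}_{\mathrm{syn}}$ is $(\varepsilon_{\mathrm{syn}},\delta_{\mathrm{syn}})$-differentially private and, for every fixed $q\in\mathcal Q$, $\mathcal{M}_{\mathrm{rel}}(\cdot\,;q)$ is $(\varepsilon_{\mathrm{rel}},\delta_{\mathrm{rel}})$-differentially private, then $\mathcal M$ is $(\varepsilon_{\mathrm{syn}}+\varepsilon_{\mathrm{rel}},\ \delta_{\mathrm{syn}}+\delta_{\mathrm{rel}})$-differentially private.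
   Context: $D\sim D'$ denotes neighboring databases: they differ by one tuple in a private relation (a symmetric relation). A randomized mechanism $\mathcal M$ is $(\varepsilon,\delta)$-differentially private if $\Pr[\mathcal M(D)\in O]\le e^{\varepsilon}\Pr[\mathcal M(D')\in O]+\delta$ for all $D\sim D'$ and all measurable output sets $O$. The internal randomness of $\mathcal{M}_{\mathrm{syn}}$, $f$ and $\mathcal{M}_{\mathrm{rel}}$ is mutually independent. The private database is accessed only by $\mathcal{M}_{\mathrm{syn}}$ and $\mathcal{M}_{\mathrm{rel}}$. *)

(* Defs.v *)
From HB Require Import structures.
From mathcomp Require Import all_boot all_order all_algebra.
From mathcomp Require Import finmap multiset.
From mathcomp Require Import all_classical all_reals all_analysis.

Set Implicit Arguments.
Unset Strict Implicit.
Unset Printing Implicit Defensive.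

Import Order.TTheory GRing.Theory Num.Theory.

Local Open Scope classical_set_scope.
Local Open Scope ring_scope.

Record schema : Type := Schema {
  relname : finType ;
  row : relname -> choiceType ;
  is_private : pred relname }.

(* Relations are bags of tuples. *)
Definition database (sch : schema) : Type :=
  forall r : relname sch, {mset row r}%mset.

(* The two usual meanings of "differ by one tuple": one side has one extra
   tuple, or one tuple is replaced by a different one.  *)
Variant adjacency := AddRemove | Replace.

Definition differ_by_one_tuple (adj : adjacency) (T : choiceType)
    (A B : {mset T}%mset) : Prop :=
  match adj with
  | AddRemove => exists t : T, (A = t +` B)%mset \/ (B = t +` A)%mset
  | Replace => exists (t t' : T) (C : {mset T}%mset),
      [/\ t <> t', A = (t +` C)%mset & B = (t' +` C)%mset]
  end.

Definition neighbors (adj : adjacency) (sch : schema)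
    (D D' : database sch) : Prop :=
  exists r : relname sch,
    [/\ is_private r, differ_by_one_tuple adj (D r) (D' r) &
        forall r' : relname sch, r' != r -> D r' = D' r'].

Lemma neighbors_sym (adj : adjacency) (sch : schema) (D D' : database sch) :
  neighbors adj D D' -> neighbors adj D' D.
Proof.
case=> r [pr dr eqD]; exists r; split => //; last by move=> r' /eqD.
case: adj dr => /= [[t [h|h]]|[t [t' [C [ne hA hB]]]]].
- by exists t; right.
- by exists t; left.
- by exists t', t, C; split => // e; apply: ne.
Qed.

(* A mechanism is represented by the random elements [M D] on a common
   probability space, so that Pr[M(D) \in O] is [P (M D @^-1` O)]. *)
Definition diff_private (R : realType) (adj : adjacency) (sch : schema)
    (dO : measure_display) (Omega : measurableType dO) (P : probability Omega R)
    (dY : measure_display) (Y : measurableType dY)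
    (M : database sch -> Omega -> Y) (eps delta : R) : Prop :=
  forall D D' : database sch, neighbors adj D D' ->
  forall O : set Y, measurable O ->
    (P (M D @^-1` O) <= (expR eps)%:E * P (M D' @^-1` O) + delta%:E)%E.

(* Since [A], [B], [C] may be [setT], the triple product rule contains the
   product rule for every subfamily. *)
Definition mutually_independent3 (R : realType)
    (dO : measure_display) (Omega : measurableType dO) (P : probability Omega R)
    (d1 d2 d3 : measure_display) (T1 : measurableType d1)
    (T2 : measurableType d2) (T3 : measurableType d3)
    (X1 : Omega -> T1) (X2 : Omega -> T2) (X3 : Omega -> T3) : Prop :=
  forall (A : set T1) (B : set T2) (C : set T3),
    measurable A -> measurable B -> measurable C ->
    P (X1 @^-1` A `&` X2 @^-1` B `&` X3 @^-1` C) =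
    (P (X1 @^-1` A) * P (X2 @^-1` B) * P (X3 @^-1` C))%E.

(* [Usyn], [Uf], [Urel] are the internal random seeds of the three stages.
   The query selection [f] sees the synthetic database and its own seed; the
   private database is not among its arguments. *)
Definition end_to_end (DB Omega Ssyn Sf Srel Syn Q Y : Type)
    (Usyn : Omega -> Ssyn) (Uf : Omega -> Sf) (Urel : Omega -> Srel)
    (Msyn : DB -> Ssyn -> Syn) (f : Syn -> Sf -> Q)
    (Mrel : DB -> Q -> Srel -> Y) (D : DB) (w : Omega) : Syn * Y :=
  let Dt := Msyn D (Usyn w) in
  let q := f Dt (Uf w) in
  (Dt, Mrel D q (Urel w)).

(* Main.v *)
(* By independence, Pr[M(D) \in O] is the integral, against the joint law of the
   synthetic database and the seed of the query selection, of the probability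
   g_D that the release of the selected query falls into the corresponding
   section of O. Privacy of the release bounds g_D by
   e^eps_rel g_D' + delta_rel pointwise. Privacy of the synthesis, a setwise
   inequality between laws, is preserved by taking the product with the law of
   an independent seed and, by the layer cake formula, extends to integrals of
   [0, 1]-valued functions. *)
Require Import Defs.
From mathcomp Require Import all_boot all_order all_algebra.
From mathcomp Require Import all_classical all_reals all_analysis.
From mathcomp Require Import measurable_realfun.

Set Implicit Arguments.
Unset Strict Implicit.
Unset Printing Implicit Defensive.

Import Order.TTheory GRing.Theory Num.Theory.

Local Open Scope classical_set_scope.
Local Open Scope ring_scope.

Section setwise_domination.
Local Open Scope ereal_scope.
Context d (T : measurableType d) (R : realType).
Variables (mu nu : {finite_measure set T -> \bar R}) (c e : R).
Hypotheses (c0 : (0 <= c)%R) (e0 : (0 <= e)%R).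
Hypothesis le_mu_nu :
  forall A, measurable A -> mu A <= c%:E * nu A + e%:E.

(** Every section of [B] over a point of [S] obeys the setwise bound; integrating it against [rho],
    of mass at most 1, does not enlarge the additive error. *)
Lemma le_product_measure d' (S : measurableType d')
    (rho : {sigma_finite_measure set S -> \bar R}) (B : set (T * S)) :
  rho setT <= 1 -> measurable B ->
  (mu \x rho) B <= c%:E * (nu \x rho) B + e%:E.
Proof.
move=> rho1 mB.
(* Tonelli: the two iterated measures agree on rectangles, so sections may be taken in [T], where
   the hypothesis lives. *)
have swap (m : {finite_measure set T -> \bar R}) :
    (m \x rho) B = \int[rho]_s m (ysection B s).
  by apply: (product_measure_unique (m' := m \x^ rho)) => // A1 A2 mA1 mA2;
    exact: product_measure2E.
rewrite !swap.
have mys (m : {finite_measure set T -> \bar R}) :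
    measurable_fun [set: S] ((fun s => m (ysection B s)) : S -> \bar R).
  exact: measurable_fun_ysection.
have ic : \int[rho]_s e%:E <= e%:E.
  by rewrite integral_cst// -[leRHS]mule1 lee_wpmul2l.
apply: (@le_trans _ _ (\int[rho]_s (c%:E * nu (ysection B s) + e%:E))).
  apply: ge0_le_integral => //.
  - by apply: emeasurable_funD => //; apply: measurable_funeM.
  - by move=> s _; apply: le_mu_nu; exact: measurable_ysection.
rewrite ge0_integralD//; last 2 first.
- by move=> s _; rewrite mule_ge0.
- exact: measurable_funeM.
by rewrite ge0_integralZl// leeD2l.
Qed.

(* Layer cake: the integral of [h] is the product measure of the region between
   0 and the graph of [h]. *)
Lemma le_integral_setwise (h : T -> R) :
  measurable_fun setT h -> (forall x, 0 <= h x <= 1)%R ->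
  \int[mu]_x (h x)%:E <= c%:E * \int[nu]_x (h x)%:E + e%:E.
Proof.
move=> mh h01.
pose RT : measurableType _ := measurableTypeR R.
have m01 : measurable (`[0%R, 1%R]%classic : set RT) by [].
have fin01 : lebesgue_measure (`[0%R, 1%R]%classic : set RT) < +oo.
  by rewrite lebesgue_measure_itv/= lte01 oppr0 adde0 ltry.
(* Lebesgue measure cut down to the unit interval: its mass is 1, as the product bound requires, and
   nothing is lost since [h] is at most 1. *)
pose rho : {finite_measure set RT -> \bar R} :=
  mfrestr (T := RT) m01 fin01.
pose B := [set z : T * RT | (0 <= z.2 < h z.1)%R].
have mB : measurable B.
  have mlt : measurable_fun setT
      (fun z : T * RT => (0 <= z.2) && (z.2 < h z.1))%R.
    apply: measurable_and.
    - by apply: measurable_fun_ler => //; exact: measurable_snd.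
    - apply: measurable_fun_ltr; first exact: measurable_snd.
      exact: measurableT_comp.
  by rewrite -[B]setTI; apply: (mlt measurableT [set true]).
have xsectionB (x : T) : xsection B x = `[0%R, h x[%classic.
  by apply/seteqP; split => t /=; rewrite /xsection/= inE/B/= in_itv.
have rho_itv (x : R) : (0 <= x <= 1)%R ->
    rho (`[0%R, x[%classic : set RT) = x%:E.
  move=> /andP[x0 x1]; rewrite /rho/= /mfrestr /mrestr setIidl; last first.
    move=> t /=; rewrite !in_itv/= => /andP[-> /ltW tx].
    exact: le_trans tx x1.
  by rewrite lebesgue_measure_itv/= lte_fin oppr0 adde0; case: ltgtP x0 => // <-.
have int_h (m : {finite_measure set T -> \bar R}) :
    \int[m]_x (h x)%:E = (m \x rho) B.
  by apply: eq_integral => x _ /=; rewrite xsectionB rho_itv.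
rewrite !int_h; apply: (le_product_measure (rho := rho)) => //.
rewrite /rho/= /mfrestr /mrestr setTI.
by rewrite lebesgue_measure_itv/= lte01 oppr0 adde0.
Qed.

(** Abstract two-stage composition: [mu] and [nu] are laws of the first stage on neighboring inputs,
    [g] and [g'] the probabilities that the second stage hits the target given the first outcome. *)
Lemma le_integral_composition (g g' : T -> R) (c' e' : R) :
  (0 <= c')%R -> (0 <= e')%R ->
  measurable_fun setT g -> measurable_fun setT g' ->
  (forall x, 0 <= g x)%R -> (forall x, g x <= 1)%R -> (forall x, 0 <= g' x)%R ->
  (forall x, g x <= c' * g' x + e')%R ->
  mu setT <= 1 ->
  \int[mu]_x (g x)%:E <=
    (c * c')%:E * \int[nu]_x (g' x)%:E + (e + e')%:E.
Proof.
move=> c'0 e'0 mg mg' g0 g1 g'0 gg' mu1.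
(* Truncating [g - e'] at 0 keeps it in [0, 1] and below [c' * g'], so that the
   two additive errors add up instead of [e'] being multiplied by [c]. *)
pose h x : R := Num.max 0%R (g x - e')%R.
have mh : measurable_fun setT h.
  by apply: measurable_maxr => //; exact: measurable_funB.
have h0 x : (0 <= h x)%R by rewrite /h le_max lexx.
have h1 x : (h x <= 1)%R.
  by rewrite /h ge_max ler01/= lerBlDr (le_trans (g1 x))// lerDl.
have gh x : (g x <= h x + e')%R by rewrite -lerBlDr /h le_max lexx orbT.
have hg' x : (h x <= c' * g' x)%R.
  by rewrite /h ge_max mulr_ge0//= lerBlDr.
have step1 : \int[mu]_x (g x)%:E <= \int[mu]_x (h x)%:E + e'%:E.
  apply: (@le_trans _ _ (\int[mu]_x ((h x)%:E + e'%:E))).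
    apply: ge0_le_integral => //.
    - by move=> x _; rewrite lee_fin.
    - exact/measurable_EFinP.
    - by apply: emeasurable_funD => //; exact/measurable_EFinP.
    - by move=> x _; rewrite -EFinD lee_fin.
  rewrite ge0_integralD//; last 2 first.
  - by move=> x _; rewrite lee_fin.
  - exact/measurable_EFinP.
  by rewrite leeD2l// integral_cst// -[leRHS]mule1 lee_wpmul2l.
have step2 : \int[nu]_x (h x)%:E <= c'%:E * \int[nu]_x (g' x)%:E.
  rewrite -ge0_integralZl//; last 2 first.
  - exact/measurable_EFinP.
  - by move=> x _; rewrite lee_fin.
  apply: ge0_le_integral => //.
  - by move=> x _; rewrite lee_fin.
  - exact/measurable_EFinP.
  - by apply: measurable_funeM; exact/measurable_EFinP.
  - by move=> x _; rewrite -EFinM lee_fin.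
apply: (le_trans step1).
have h01 x : (0 <= h x <= 1)%R by rewrite h0 h1.
rewrite EFinD addeA leeD2r// (le_trans (le_integral_setwise mh h01))//.
by rewrite leeD2r// EFinM -muleA lee_wpmul2l.
Qed.

End setwise_domination.

Section independence.
Local Open Scope ereal_scope.
Context dO (Omega : measurableType dO) (R : realType) (P : probability Omega R).
Context d1 (T1 : measurableType d1) d2 (T2 : measurableType d2)
  d3 (T3 : measurableType d3).
Variables (X1 : {mfun Omega >-> T1}) (X2 : {mfun Omega >-> T2})
  (X3 : {mfun Omega >-> T3}).

(** Rectangles determine a product measure, but here their first side is an arbitrary measurable
    subset of [T1 * T2], while independence covers only products of sets. Hence two nested
    uniqueness arguments. *)
Lemma mutually_independent3_joint :
  mutually_independent3 P X1 X2 X3 ->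
  forall O : set (T1 * T2 * T3), measurable O ->
    P ((fun w => (X1 w, X2 w, X3 w)) @^-1` O) =
    (distribution P X1 \x distribution P X2 \x distribution P X3) O.
Proof.
move=> ind O mO.
have mX12 : measurable_fun setT (fun w => (X1 w, X2 w)).
  exact: measurable_fun_pair.
have mX123 : measurable_fun setT (fun w => (X1 w, X2 w, X3 w)).
  exact: measurable_fun_pair.
pose X12 : {mfun Omega >-> (T1 * T2)%type} := mfun_Sub (mem_set mX12).
pose X123 : {mfun Omega >-> (T1 * T2 * T3)%type} := mfun_Sub (mem_set mX123).
pose mu12 : subprobability (T1 * T2)%type R :=
  product_subprobability (distribution P X1 : subprobability _ _,
                          distribution P X2 : subprobability _ _).
rewrite -[LHS]/(distribution P X123 O) -[RHS]/((mu12 \x distribution P X3) O).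
rewrite (product_measure_unique (m' := distribution P X123))// => A C mA mC.
(* For fixed [C], both sides are finite measures in [A] that agree on
   rectangles. *)
have mX3C : measurable (X3 @^-1` C) by exact: measurable_funPTI.
(* The factor P(X3 in C) is absorbed into the first marginal, so that the target is again a product
   measure. *)
pose k : {nonneg R} := NngNum (fine_ge0 (measure_ge0 P (X3 @^-1` C))).
have kE : k%:num%:E = P (X3 @^-1` C) by rewrite /= fineK// fin_num_measure.
pose m1 : {finite_measure set T1 -> \bar R} := mscale k (distribution P X1).
(* The measure structure of [pushforward] needs a proof of measurability, which
   [pose] abstracts. *)
pose m' : {measure set (T1 * T2)%type -> \bar R} :=
  pushforward (mrestr P mX3C) X12.
transitivity (m' mX12 A) => //.
rewrite -(product_measure_unique
  (m1 := m1) (m2 := distribution P X2) (m' := m' mX12))//.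
  rewrite /product_measure1/= ge0_integral_mscale//; last first.
    exact: measurable_fun_xsection.
  by rewrite muleC; congr (_ * _); exact: kE.
move=> B1 B2 mB1 mB2.
by rewrite /m1/= /mscale kE /m'/= /pushforward /mrestr ind// muleC muleA.
Qed.

End independence.

Theorem theorem1 (R : realType) (adj : adjacency) (sch : schema)
    (* probability space and internal random seeds *)
    (dO : measure_display) (Omega : measurableType dO) (P : probability Omega R)
    (d1 : measure_display) (Ssyn : measurableType d1)
    (d2 : measure_display) (Sf : measurableType d2)
    (d3 : measure_display) (Srel : measurableType d3)
    (Usyn : Omega -> Ssyn) (Uf : Omega -> Sf) (Urel : Omega -> Srel)
    (mUsyn : measurable_fun [set: Omega] Usyn)
    (mUf : measurable_fun [set: Omega] Uf)
    (mUrel : measurable_fun [set: Omega] Urel)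
    (indep : mutually_independent3 P Usyn Uf Urel)
    (* synthetic databases, query class, release outputs, questions *)
    (d4 : measure_display) (Syn : measurableType d4)
    (d5 : measure_display) (Q : measurableType d5)
    (d6 : measure_display) (Y : measurableType d6)
    (Question : Type)
    (Msyn : database sch -> Ssyn -> Syn)
    (f : Question -> schema -> Syn -> Sf -> Q)
    (Mrel : database sch -> Q -> Srel -> Y)
    (question : Question)
    (mMsyn : forall D : database sch, measurable_fun [set: Ssyn] (Msyn D))
    (mf : measurable_fun [set: Syn * Sf]
            (fun x : Syn * Sf => f question sch x.1 x.2))
    (mMrel : forall D : database sch,
       measurable_fun [set: Q * Srel] (fun x : Q * Srel => Mrel D x.1 x.2))
    (eps_syn delta_syn eps_rel delta_rel : R)
    (dp_syn : diff_private adj P (fun (D : database sch) (w : Omega) =>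
                Msyn D (Usyn w)) eps_syn delta_syn)
    (dp_rel : forall q : Q,
       diff_private adj P (fun (D : database sch) (w : Omega) =>
                Mrel D q (Urel w)) eps_rel delta_rel) :
  diff_private adj P
    (end_to_end Usyn Uf Urel Msyn (f question sch) Mrel)
    (eps_syn + eps_rel) (delta_syn + delta_rel).
Proof.
move=> D D' DD' O mO.
(* Privacy on the empty output set forces a nonnegative additive error. *)
have delta_ge0 (e x : R) : (P set0 <= e%:E * P set0 + x%:E)%E -> 0 <= x.
  by rewrite measure0 mule0 add0e lee_fin.
have delta_syn0 : 0 <= delta_syn := delta_ge0 _ _ (dp_syn _ _ DD' _ measurable0).
have delta_rel0 : 0 <= delta_rel.
  exact: delta_ge0 (dp_rel (f question sch point point) _ _ DD' _ measurable0).
pose U2 : {mfun Omega >-> Sf} := mfun_Sub (mem_set mUf).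
pose U3 : {mfun Omega >-> Srel} := mfun_Sub (mem_set mUrel).
have mX E : measurable_fun setT (Msyn E \o Usyn) by exact: measurableT_comp.
pose X E : {mfun Omega >-> Syn} := mfun_Sub (mem_set (mX E)).
pose eta E : subprobability (Syn * Sf)%type R :=
  product_subprobability (distribution P (X E) : subprobability _ _,
                          distribution P U2 : subprobability _ _).
(* The output as a function of the synthetic database and the two remaining seeds, which are
   independent. *)
pose view E (u : Syn * Sf * Srel) :=
  (u.1.1, Mrel E (f question sch u.1.1 u.1.2) u.2).
have mview E : measurable_fun setT (view E).
  apply: measurable_fun_pair; first exact: measurableT_comp.
  apply: (measurableT_comp (mMrel E)
    (g := fun u : Syn * Sf * Srel => (f question sch u.1.1 u.1.2, u.2))).
  apply: measurable_fun_pair => //.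
  exact: (measurableT_comp mf).
have mviewO E : measurable (view E @^-1` O).
  by rewrite -[X in measurable X]setTI; exact: mview.
pose g E z := fine (distribution P U3 (xsection (view E @^-1` O) z)).
have gE E z : (g E z)%:E = distribution P U3 (xsection (view E @^-1` O) z).
  by rewrite fineK// fin_num_measure//; exact: measurable_xsection.
have mg E : measurable_fun setT (g E).
  apply: measurableT_comp => //.
  exact: (measurable_fun_xsection (distribution P U3)).
have PE E : P (end_to_end Usyn Uf Urel Msyn (f question sch) Mrel E @^-1` O) =
    (\int[eta E]_z (g E z)%:E)%E.
  have ind : mutually_independent3 P (X E) U2 U3.
    move=> A B C mA mB mC.
    apply: (indep (Msyn E @^-1` A) B C) => //.
    by rewrite -[X in measurable X]setTI; exact: mMsyn.
  under eq_integral do rewrite gE.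
  exact: (mutually_independent3_joint ind (mviewO E)).
rewrite !PE expRD; apply: le_integral_composition => //.
- move=> A mA; apply: le_product_measure => //.
  + by move=> B mB; exact: dp_syn.
  + by rewrite /= probability_setT.
- by move=> z; rewrite -lee_fin gE.
- by move=> z; rewrite -lee_fin gE probability_le1//; exact: measurable_xsection.
- by move=> z; rewrite -lee_fin gE.
- move=> z; rewrite -lee_fin EFinD EFinM !gE.
  have mOz : measurable (xsection O z.1) by exact: measurable_xsection.
  (* Fixing [z] fixes both the query and the section of [O], neither depending on [E], so privacy of
     the release at that query applies. *)
  have secE E : distribution P U3 (xsection (view E @^-1` O) z) =
      P ((fun w => Mrel E (f question sch z.1 z.2) (Urel w)) @^-1`
           xsection O z.1).
    by congr (P _); apply/seteqP; split => w /=; rewrite /xsection/= !inE.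
  rewrite !secE; exact: dp_rel.
- exact: sprobability_setT.
Qed.
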